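(* Let $N\in\mathbb{N}$, let $\alpha\in\mathbb{R}\setminus\mathbb{Q}$, let $p_k/q_k$ ($k\ge0$) denote the convergents of the simple continued fraction expansion of $\alpha$, and let $K$ be the largest integer such that $q_K\le N$. Let $\gamma\in\mathbb{R}$ and let $n'$ be the (unique) integer with $0\le n'\le N$ such that $\{n'\alpha-\gamma\}=\min_{0\le n\le N}\{n\alpha-\gamma\}$. For a real number $b>0$ define $$T^b_N(\alpha,\gamma):=\sum_{\substack{0\le n\le N\\ n\neq n'}}\frac{1}{\{n\alpha-\gamma\}^b}.$$ Then $$T^b_N(\alpha,\gamma)\le 2^{1+b}\zeta(b)N^b+2^b\zeta(b)q_{K+1}^b\qquad\text{if } b>1,$$ and $$T^b_N(\alpha,\gamma)\le \frac{2^{1+b}}{1-b}N+\frac{2^b}{1-b}q_{K+1}^b\left(\frac{N}{q_K}\right)^{1-b}\qquad\text{if } 0<b<1,$$ where $\zeta(b)=\sum_{j=1}^\infty j^{-b}$.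
   Context: For $x\in\mathbb{R}$, $\{x\}=x-[x]$ denotes the fractional part of $x$. If $\alpha=[a_0;a_1,a_2,\dots]$ is the simple continued fraction expansion of $\alpha$, the convergents $p_k/q_k=[a_0;a_1,\dots,a_k]$ are given by $p_{-1}=1$, $q_{-1}=0$, $p_0=a_0$, $q_0=1$, $p_{k+1}=a_{k+1}p_k+p_{k-1}$, $q_{k+1}=a_{k+1}q_k+q_{k-1}$ for $k\ge 0$. *)

(* Defs.v *)
From HB Require Import structures.
From mathcomp Require Import all_boot all_order all_algebra.
From mathcomp Require Import all_classical all_reals all_analysis.
Set Implicit Arguments.
Unset Strict Implicit.
Unset Printing Implicit Defensive.
Import Order.TTheory GRing.Theory Num.Theory.
Import numFieldNormedType.Exports.
Local Open Scope ring_scope.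

Definition fract_part (R : realType) (x : R) : R := x - (Num.floor x)%:~R.

(* Complete quotients alpha_0 = alpha, alpha_(k+1) = 1 / {alpha_k}; for
   irrational alpha every {alpha_k} is nonzero. *)
Fixpoint cf_tail (R : realType) (alpha : R) (k : nat) : R :=
  if k is k'.+1 then (fract_part (cf_tail alpha k'))^-1 else alpha.

Definition cf_coef (R : realType) (alpha : R) (k : nat) : int :=
  Num.floor (cf_tail alpha k).

(* The pair (x_k, x_(k-1)) for x_(k+1) = a_(k+1) x_k + x_(k-1), started from
   x_0 and x_(-1). *)
Fixpoint cf_rec (a : nat -> int) (x0 xm1 : int) (k : nat) : int * int :=
  if k is k'.+1 then
    let: (x, y) := cf_rec a x0 xm1 k' in (a k'.+1 * x + y, x)
  else (x0, xm1).

Definition cf_num (R : realType) (alpha : R) (k : nat) : int :=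
  (cf_rec (cf_coef alpha) (cf_coef alpha 0) 1 k).1.

Definition cf_den (R : realType) (alpha : R) (k : nat) : int :=
  (cf_rec (cf_coef alpha) 1 0 k).1.

(* riemannR is indexed from 0: its j-th term is (j+1)^(-b). *)
Definition zeta (R : realType) (b : R) : R := limn (series (riemannR b)).

(* The minimizer n' is passed explicitly. *)
Definition T_sum (R : realType) (b : R) (N n' : nat) (alpha gamma : R) : R :=
  \sum_(0 <= n < N.+1 | n != n') (fract_part (n%:R * alpha - gamma) `^ b)^-1.

(* Main.v *)
(* Put q = q_K, Q = q_(K+1) and x_n = {n alpha - gamma}.  Writing (m, p) in the
   basis (q_(k-1), p_(k-1)), (q_k, p_k) of Z^2 gives |m alpha - p| >= 1/(2 q_k)
   for 0 < m < q_k.  Hence the x_n with n <= N are 1/(2Q)-spaced, and those with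
   n in a block of q consecutive integers are 1/(2q)-spaced; the j-th smallest
   of d-spaced reals that are >= d is >= j d.
   For b > 1 the first spacing alone bounds the sum by (2Q)^b zeta(b).
   For b < 1 let L = floor(N / q), so that L + 1 <= 2N/q blocks cover {0..N}.
   Each block has at most one x_n below 1/(2q), and if there are such points n'
   is one of them: the others, at most L, contribute at most
   (2Q)^b (1^-b + ... + L^-b).  The x_n >= 1/(2q) contribute at most
   (2q)^b (1^-b + ... + q^-b) per block. *)
Require Import Defs.
From HB Require Import structures.
From mathcomp Require Import all_boot all_order all_algebra.
From mathcomp Require Import all_classical all_reals all_analysis.
From mathcomp Require Import ring lra zify.
Import Order.TTheory GRing.Theory Num.Theory.
Import numFieldNormedType.Exports.
Local Open Scope ring_scope.

(** * Fractional parts *)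

Lemma fract_part_itv {R : realType} (x : R) : 0 <= fract_part x < 1.
Proof.
rewrite /fract_part subr_ge0 floor_le ltrBlDl.
by have := floorD1_gt x; rewrite intrD addrC.
Qed.

Lemma irrational_fract_part_gt0 {R : realType} (x : R) :
  irrational x -> 0 < fract_part x.
Proof.
move=> irrx; have /andP[+ _] := fract_part_itv x.
rewrite le_eqVlt => /predU1P[/esym/eqP|//]; rewrite subr_eq0 => /eqP xE.
by case: irrx; exists (Num.floor x)%:~R; rewrite // ratr_int -xE.
Qed.

(** * Continued fractions: recurrences, errors, and the distance from m alpha to an integer *)

Section ContinuedFraction.
Variables (R : realType) (alpha : R).
Hypothesis irr_alpha : irrational alpha.

Local Notation t := (cf_tail alpha).
Local Notation a := (cf_coef alpha).
Local Notation p := (cf_num alpha).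
Local Notation q := (cf_den alpha).

Lemma cf_tail_irrational k : irrational (t k).
Proof.
elim: k => // k irrk [r _ rE]; apply: irrk.
exists ((Num.floor (t k))%:~R + r^-1) => //.
by rewrite rmorphD /= fmorphV /= ratr_int rE /= invrK addrC subrK.
Qed.

Lemma fract_cf_tail_gt0 k : 0 < fract_part (t k).
Proof. exact/irrational_fract_part_gt0/cf_tail_irrational. Qed.

Lemma cf_coefE k : (a k)%:~R = t k - fract_part (t k).
Proof. by rewrite /fract_part subKr. Qed.

Lemma cf_coef_gt0 k : 0 < a k.+1.
Proof.
have /andP[_ f1] := fract_part_itv (t k).
rewrite /cf_coef gtz0_ge1 floor_ge_int /=.
by rewrite invf_ge1 ?fract_cf_tail_gt0// ltW.
Qed.

Lemma cf_recSS (c : nat -> int) x0 xm1 k :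
  (cf_rec c x0 xm1 k.+2).1 =
  c k.+2 * (cf_rec c x0 xm1 k.+1).1 + (cf_rec c x0 xm1 k).1.
Proof. by rewrite /=; case: (cf_rec c x0 xm1 k). Qed.

Lemma cf_denSS k : q k.+2 = a k.+2 * q k.+1 + q k.
Proof. exact: cf_recSS. Qed.

Lemma cf_numSS k : p k.+2 = a k.+2 * p k.+1 + p k.
Proof. exact: cf_recSS. Qed.

Lemma cf_den_bounds k : 0 < q k <= q k.+1.
Proof.
elim: k => [|k /andP[qk qk1]].
  by rewrite /cf_den /= mulr1 addr0 -gtz0_ge1 cf_coef_gt0.
rewrite cf_denSS; have := cf_coef_gt0 k.+1; nia.
Qed.

Lemma cf_den_gt0 k : 0 < q k.
Proof. by case/andP: (cf_den_bounds k). Qed.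

(** Squaring the determinant, which is 1 or -1, avoids tracking its sign. *)
Lemma cf_det_sqr k : (p k.+1 * q k - p k * q k.+1) ^+ 2 = 1.
Proof.
elim: k => [|k IH]; first by rewrite /cf_num /cf_den /=; ring.
by rewrite -[RHS]IH cf_denSS cf_numSS; ring.
Qed.

(** As [t k.+2] is the inverse of [fract_part (t k.+1)], the recurrence for the errors collapses to
    the factor a_(k+2) - t_(k+2). Consecutive errors thus have opposite signs. *)
Lemma cf_errorS k :
  (q k.+1)%:~R * alpha - (p k.+1)%:~R =
  - fract_part (t k.+1) * ((q k)%:~R * alpha - (p k)%:~R).
Proof.
elim: k => [|k IH].
  have /= f0 := lt0r_neq0 (fract_cf_tail_gt0 0).
  rewrite /cf_den /cf_num /= !(intrD, intrM) !cf_coefE /=.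
  by field.
have fk := lt0r_neq0 (fract_cf_tail_gt0 k.+1).
rewrite cf_denSS cf_numSS !(intrD, intrM) cf_coefE.
set D1 := (q k.+1)%:~R * _ - _ in IH *.
have D0E : (q k)%:~R * alpha - (p k)%:~R = - t k.+2 * D1.
  by rewrite IH /= !mulNr mulrN opprK mulKf.
transitivity ((t k.+2 - fract_part (t k.+2)) * D1
              + ((q k)%:~R * alpha - (p k)%:~R)); first by rewrite /D1; ring.
by rewrite D0E; ring.
Qed.

(** The coordinates [u], [v] in the basis of convergents have weakly opposite signs, and so do
    consecutive errors, so the two contributions add up instead of cancelling. *)
Lemma dist_int_mul_ge k (m p0 : int) : 0 < m < q k ->
  (2 * (q k)%:~R)^-1 <= `|m%:~R * alpha - p0%:~R|.
Proof.
case: k => [|k]; first by rewrite {1}/cf_den /=; lia.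
case/andP=> m0 mq; have /andP[q0 qle] := cf_den_bounds k.
have [u [v [mE pE]]] : exists u v : int,
    m = u * q k + v * q k.+1 /\ p0 = u * p k + v * p k.+1.
  have d1 := cf_det_sqr k.
  set d := p k.+1 * q k - _ in d1.
  (* Cramer's rule; [d] is its own inverse because its square is 1. *)
  exists (d * (m * p k.+1 - p0 * q k.+1)), (d * (p0 * q k - m * p k)).
  by split; rewrite -[LHS]mul1r -d1 /d; ring.
have /andP[f0 f1] := fract_part_itv (t k.+1).
set f := fract_part _ in f0 f1.
set D := (q k)%:~R * alpha - (p k)%:~R.
have errE : m%:~R * alpha - p0%:~R = (u%:~R - v%:~R * f) * D.
  have := cf_errorS k; rewrite -/f -/D mE pE !(intrD, intrM) => E.
  transitivity (u%:~R * D + v%:~R * ((q k.+1)%:~R * alpha - (p k.+1)%:~R)).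
    by rewrite /D; ring.
  by rewrite E; ring.
have fq0 : 0 < (q k)%:~R :> R by rewrite ltr0z.
have fq1 : (q k)%:~R <= (q k.+1)%:~R :> R by rewrite ler_int.
(* The determinant equals [D] times q_(k+1) + [f] q_k, a factor of at most 2 q_(k+1). *)
have Dge : (2 * (q k.+1)%:~R)^-1 <= `|D|.
  have /(congr1 (fun z : int => z%:~R : R)) := cf_det_sqr k.
  have := cf_errorS k; rewrite -/f -/D => E.
  rewrite rmorphXn /= intrB !intrM => /eqP; rewrite sqrf_eq1 => detE.
  have /(congr1 Num.norm) : D * ((q k.+1)%:~R + f * (q k)%:~R) =
      (p k.+1)%:~R * (q k)%:~R - (p k)%:~R * (q k.+1)%:~R.
    transitivity ((q k.+1)%:~R * D - (q k)%:~R * (- f * D)); first by ring.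
    by rewrite -E /D; ring.
  have -> : `|(p k.+1)%:~R * (q k)%:~R - (p k)%:~R * (q k.+1)%:~R| = 1 :> R.
    by case/orP: detE => /eqP ->; rewrite ?normrN normr1.
  rewrite normrM => Dq; rewrite -[leLHS]mul1r ler_pdivrMr; last by lra.
  have fq : 0 <= f * (q k)%:~R by rewrite mulr_ge0// ltW.
  have fqle : f * (q k)%:~R <= (q k)%:~R by rewrite ger_pMl// ltW.
  by rewrite -[leLHS]Dq ler_wpM2l// ger0_norm; lra.
rewrite errE normrM (le_trans Dge)// ler_peMl//.
(* Forced by 0 < m < q_(k+1); it yields |u - v f| >= 1. *)
have : (u <= -1) && (0 <= v) \/ (1 <= u) && (v <= 0).
  clear -mE m0 mq q0.
  have [v0|v0] := leP 1 v; first by left; nia.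
  by have [v1|v1] := leP v (-1); right; nia.
rewrite -![(u <= _)%R](ler_int R) -![(1 <= u)%R](ler_int R).
rewrite -![(v <= _)%R](ler_int R) -![(0 <= v)%R](ler_int R).
by case=> /andP[uR vR]; rewrite ler_normr; apply/orP; [right|left]; nra.
Qed.

End ContinuedFraction.

(** * Tangent-line inequalities and partial sums of the series of j^(-b) *)

Lemma powR_le_tangent {R : realType} (a u : R) :
  0 < a < 1 -> 0 <= u -> u `^ a <= 1 + a * (u - 1).
Proof.
case/andP=> a0 a1 u0; have b0 : 0 < 1 - a by lra.
(* Young's inequality for the product of u^a and 1, with exponents 1/a and 1/(1-a). *)
have := @conjugate_powR R (u `^ a) 1 a^-1 (1 - a)^-1.
rewrite powR_ge0 ler01 !invr_gt0 !invrK a0 b0 powR1 mulr1 -powRrM.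
by rewrite divff ?lt0r_neq0// powRr1// => /(_ isT isT isT isT); lra.
Qed.

(** Two bounds are chained: exp y >= 1 + y at y = -c ln u, then ln u <= u - 1. *)
Lemma powRN_ge_tangent {R : realType} (c u : R) :
  0 <= c -> 0 < u -> 1 + c * (1 - u) <= u `^ (- c).
Proof.
move=> c0 u0; rewrite /powR gt_eqF//.
apply: le_trans (expR_ge1Dx _); rewrite lerD2l mulNr -mulrN ler_wpM2l//.
by have := @le_ln1Dx R (u - 1); rewrite [1 + _]addrC subrK; lra.
Qed.

(** A discrete comparison with the integral of t^(-b) over [0, n]: writing M - 1 = (1 - 1/M) M, the
    tangent bound shows that M^(1-b) grows by at least (1-b) M^(-b) from M - 1 to M. *)
Lemma series_riemannR_le {R : realType} (b : R) n :
  0 < b < 1 -> series (riemannR b) n <= n%:R `^ (1 - b) / (1 - b).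
Proof.
case/andP=> b0 b1; have c0 : 0 < 1 - b by lra.
rewrite ler_pdivlMr//.
elim: n => [|n IH]; first by rewrite /series /= big_geq// mul0r powR_ge0.
rewrite /series /= big_nat_recr//= mulrDl.
set M : R := n.+1%:R; have M0 : 0 < M by rewrite ltr0n.
apply: le_trans (lerD IH (lexx _)) _.
have -> : n%:R = (1 - M^-1) * M :> R.
  by rewrite mulrBl mulVf ?lt0r_neq0// /M -natr1; ring.
have u0 : 0 <= 1 - M^-1 by rewrite subr_ge0 invf_le1// ler1n.
rewrite powRM ?(ltW M0)//.
have c01 : 0 < 1 - b < 1 by lra.
have /(ler_wpM2r (powR_ge0 M (1 - b))) := powR_le_tangent _ _ c01 u0.
rewrite /riemannR -/M.
suff -> : (M `^ b)^-1 = M^-1 * M `^ (1 - b).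
  move=> H; rewrite -lerBrDr (le_trans H)// le_eqVlt.
  by apply/orP; left; apply/eqP; ring.
rewrite powRB; last by rewrite lt0r_neq0 ?implybT.
by rewrite powRr1 ?(ltW M0)// mulKf// lt0r_neq0.
Qed.

Lemma series_riemannR_nd {R : realType} (b : R) :
  nondecreasing_seq (series (riemannR b)).
Proof.
apply/nondecreasing_seqP => n.
by rewrite /series /= big_nat_recr//= lerDl invr_ge0 powR_ge0.
Qed.

Lemma cvg_series_riemannR {R : realType} (b : R) :
  1 < b -> cvgn (series (riemannR b)).
Proof.
move=> b1; pose c := b - 1; have c0 : 0 < c by rewrite /c; lra.
apply: nondecreasing_is_cvgn (series_riemannR_nd b) _.
(* The bound is 1 plus the integral of t^(-b) over [1, n+1]; starting at [n.+1] keeps the base of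
   the negative power positive. *)
suff H n : series (riemannR b) n.+1 <= 1 + c^-1 - n.+1%:R `^ (- c) / c.
  exists (1 + c^-1) => _ [n _ <-].
  apply: le_trans (series_riemannR_nd b _ _ (leqnSn n)) _.
  by rewrite (le_trans (H n))// gerBl divr_ge0 ?powR_ge0// ltW.
elim: n => [|n IH].
  by rewrite /series /= big_nat1 /riemannR !powR1 invr1 mul1r addrK.
rewrite /series /= big_nat_recr//=; apply: le_trans (lerD IH (lexx _)) _.
set M : R := n.+2%:R; have M0 : 0 < M by rewrite ltr0n.
have -> : n.+1%:R = (1 - M^-1) * M :> R.
  by rewrite mulrBl mulVf ?lt0r_neq0// /M -natr1; ring.
have u0 : 0 < 1 - M^-1 by rewrite subr_gt0 invf_lt1// ltr1n.
rewrite powRM ?(ltW M0) ?(ltW u0)//.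
have := @powRN_ge_tangent R c _ (ltW c0) u0; rewrite subKr.
move=> /(ler_wpM2r (powR_ge0 M (- c))).
rewrite /riemannR -/M.
have -> : (M `^ b)^-1 = M^-1 * M `^ (- c).
  rewrite /c opprB powRB; last by rewrite lt0r_neq0 ?implybT.
  by rewrite powRr1 ?(ltW M0)// mulKf// lt0r_neq0.
set P := M `^ (- c); set U := (1 - M^-1) `^ (- c) => H.
suff : M^-1 * P <= (U * P - P) / c.
  by rewrite mulrBl; move: (M^-1 * P) (U * P / c) (P / c) c^-1 => *; lra.
rewrite ler_pdivlMr// lerBrDr (le_trans _ H)// le_eqVlt.
by apply/orP; left; apply/eqP; ring.
Qed.

(** * Power sums over well-spaced reals *)

Lemma sum_inv_powR_spaced {R : realType} (b d : R) (s : seq R) :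
  0 < b -> 0 < d -> uniq s -> {in s, forall x, d <= x} ->
  {in s &, forall x y, x != y -> d <= `|x - y|} ->
  \sum_(x <- s) (x `^ b)^-1 <= (d `^ b)^-1 * series (riemannR b) (size s).
Proof.
move=> b0 d0 us sd sdist.
have term_le k z : k.+1%:R * d <= z ->
    (z `^ b)^-1 <= (d `^ b)^-1 * riemannR b k.
  have kd : 0 < k.+1%:R * d by rewrite mulr_gt0.
  move=> kz; rewrite /riemannR -invfM -powRM ?(ltW d0)//.
  have z0 := lt_le_trans kd kz.
  rewrite lef_pV2 ?posrE ?powR_gt0 1?mulrC//.
  by rewrite ge0_ler_powR ?nnegrE ?(ltW kd) ?(ltW z0) ?(ltW b0).
have : sorted <%O (sort <=%O s) by rewrite sort_lt_sorted.
rewrite -(size_sort <=%O s) -(perm_big _ (permEl (perm_sort <=%O s))) /=.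
have {us} {}sd : {in sort <=%O s, forall x, d <= x}.
  by move=> x; rewrite mem_sort => /sd.
have {}sdist : {in sort <=%O s &, forall x y, x != y -> d <= `|x - y|}.
  by move=> x y; rewrite !mem_sort => xs ys; apply: sdist.
have spaced : {in sort <=%O s &, forall x y, x < y -> x + d <= y}.
  move=> x y xs ys xy.
  rewrite -lerBrDl -(gtr0_norm (_ : 0 < y - x)) ?subr_gt0//.
  by rewrite sdist// gt_eqF.
move=> /(sub_in_sorted (spaced : {in mem (sort <=%O s) &, _}) (allss _)).
case: (sort _ _) sd {sdist spaced} => [|x l] sd.
  by rewrite big_nil /series /= big_geq ?mulr0.
(* The offset [k] makes the induction work: passing to the tail raises the lower bound on the head
   from (k+1) d to (k+2) d. *)
suff H k z t : path (fun x y => x + d <= y) z t -> k.+1%:R * d <= z ->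
    \sum_(y <- z :: t) (y `^ b)^-1 <=
    (d `^ b)^-1 * \sum_(0 <= j < (size t).+1) riemannR b (k + j)%N.
  by move=> /(H 0%N); apply; rewrite mul1r sd ?mem_head.
elim: t z k => [|y t IH] z k /= zt kz; rewrite big_cons big_nat_recl//= mulrDr.
  rewrite big_nil big_geq// mulr0 !addr0 addn0; exact: term_le.
case/andP: zt => zy yt; rewrite addn0 lerD ?term_le//.
have ky : k.+2%:R * d <= y.
  by rewrite -natr1 mulrDl mul1r (le_trans _ zy)// lerD2r.
by under [in leRHS]eq_bigr => j _ do rewrite addnS -addSn; exact: IH.
Qed.

Lemma powR_invr {R : realType} (x b : R) : 0 <= x -> (x^-1 `^ b)^-1 = x `^ b.
Proof. by move=> x0; rewrite -(powR_inv1 x0) -powRrM mulN1r powRN invrK. Qed.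

(** Indexed form for use on the orbit; the separation makes [x] injective on [s], so distinct
    indices give distinct values. *)
Lemma sum_inv_powR_spaced_map {R : realType} {T : eqType} (b D : R) (s : seq T)
    (x : T -> R) :
  0 < b -> 0 < D -> uniq s -> {in s, forall n, D^-1 <= x n} ->
  {in s &, forall m n, m != n -> D^-1 <= `|x m - x n|} ->
  \sum_(n <- s) (x n `^ b)^-1 <= D `^ b * series (riemannR b) (size s).
Proof.
move=> b0 D0 us sD sdist; have d0 : 0 < D^-1 by rewrite invr_gt0.
have xinj : {in s &, injective x}.
  move=> m n ms ns xmn; apply/eqP; apply/negPn/negP => /(sdist _ _ ms ns).
  by rewrite xmn subrr normr0 leNgt d0.
rewrite -(powR_invr _ _ (ltW D0)) -(size_map x s).
rewrite -(big_map x predT (fun y => (y `^ b)^-1)).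
apply: sum_inv_powR_spaced => //; first by rewrite map_inj_in_uniq.
  by move=> _ /mapP[n ns ->]; exact: sD.
move=> _ _ /mapP[m ms ->] /mapP[n ns ->] xmn; apply: sdist => //.
by apply: contraNneq xmn => ->.
Qed.

(** * Spacing of the points {n alpha - gamma} *)

Section Orbit.
Variables (R : realType) (alpha gamma : R).
Hypothesis irr_alpha : irrational alpha.

Local Notation q := (cf_den alpha).
Local Notation x n := (fract_part (n%:R * alpha - gamma)).

(** The difference of two points is (m - n) alpha minus an integer. *)
Lemma fract_part_spaced k (m n : nat) : m != n -> `|m%:Z - n%:Z| < q k ->
  (2 * (q k)%:~R)^-1 <= `|x m - x n|.
Proof.
wlog nm : m n / (n < m)%N => [IH|_ mn].
  rewrite neq_ltn => /orP[mn mnq|nm mnq]; last by apply: IH; rewrite ?gtn_eqF.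
  by rewrite distrC; apply: IH; rewrite 1?distrC// gtn_eqF.
pose fl j : int := Num.floor (j%:R * alpha - gamma).
have -> : x m - x n = (m%:Z - n%:Z)%:~R * alpha - (fl m - fl n)%:~R.
  by rewrite /fract_part -/(fl m) -/(fl n) !intrB -!pmulrn; ring.
by apply: dist_int_mul_ge => //; lia.
Qed.

Lemma two_cf_den_gt0 k : 0 < 2 * (q k)%:~R :> R.
Proof. by rewrite mulr_gt0// ltr0z cf_den_gt0. Qed.

(** Pigeonhole on the N %/ r + 1 blocks: two points of [0, d) in one block would be closer than [d].
    If some other point is small, so is the minimal one, and [n'] then occupies a block of its
    own. *)
Lemma count_small_le k (N r n' : nat) : q k = r%:Z -> (n' <= N)%N ->
  (forall n : nat, (n <= N)%N -> x n' <= x n) ->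
  (count (fun n => (n != n') && ~~ ((2 * (q k)%:~R)^-1 <= x n)%R)
     (index_iota 0 N.+1) <= N %/ r)%N.
Proof.
move=> qr n'N xmin.
have r0 : (0 < r)%N by have := @cf_den_gt0 _ _ irr_alpha k; lia.
rewrite -size_filter; set s := [seq _ <- _ | _].
have [->//|[n0 n0s]] : size s = 0%N \/ exists n, n \in s.
  by case: s => [|n l]; [left|right; exists n; rewrite mem_head].
set d := (2 * (q k)%:~R)^-1 in s n0s *.
have sP n : n \in n' :: s -> (n <= N)%N /\ x n < d.
  rewrite inE => /predU1P[->|]; last first.
    rewrite mem_filter mem_index_iota ltnS -ltNge.
    by move=> /andP[/andP[_ xn] nN]; split.
  split=> //; move: n0s; rewrite mem_filter mem_index_iota ltnS -ltNge.
  by move=> /andP[/andP[_ +] /xmin]; move=> /[swap]; exact: le_lt_trans.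
have us : uniq (n' :: s) by rewrite /= mem_filter eqxx filter_uniq ?iota_uniq.
have dinj : {in n' :: s &, injective (fun n => (n %/ r)%N)}.
  move=> m n /sP[_ xm] /sP[_ xn] mnr; apply/eqP/negPn/negP => mn.
  have := @fract_part_spaced k m n mn; rewrite -/d leNgt => /(_ _)/negP[].
    by rewrite qr; have := divn_eq m r; have := divn_eq n r;
       have := ltn_pmod m r0; have := ltn_pmod n r0; rewrite mnr; lia.
  have /andP[xm0 _] := fract_part_itv (m%:R * alpha - gamma).
  have /andP[xn0 _] := fract_part_itv (n%:R * alpha - gamma).
  by rewrite ltr_norml; lra.
have : (size [seq (n %/ r)%N | n <- n' :: s] <= size (iota 0 (N %/ r).+1))%N.
  apply: uniq_leq_size; first by rewrite map_inj_in_uniq.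
  move=> _ /mapP[n /sP[nN _] ->].
  by rewrite mem_iota ltnS leq_div2r.
by rewrite size_map size_iota.
Qed.

Variable b : R.
Hypothesis b0 : 0 < b.

(** Removing [n'] keeps the points away from 0: x_n >= x_n - x_n' >= 1/(2 q_k). The predicate [P]
    serves both the full sum and the sum over small points. *)
Lemma sum_off_min_le k (N n' : nat) (P : pred nat) :
  N%:Z < q k -> (n' <= N)%N ->
  (forall n : nat, (n <= N)%N -> x n' <= x n) ->
  \sum_(0 <= n < N.+1 | (n != n') && P n) (x n `^ b)^-1 <=
  (2 * (q k)%:~R) `^ b *
  series (riemannR b) (count (fun n => (n != n') && P n) (index_iota 0 N.+1)).
Proof.
move=> Nq n'N xmin; rewrite -big_filter -size_filter.
have near m n : (m <= N)%N -> (n <= N)%N -> m != n ->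
    (2 * (q k)%:~R)^-1 <= `|x m - x n|.
  by move=> mN nN mn; apply: fract_part_spaced => //; lia.
apply: sum_inv_powR_spaced_map => //; rewrite ?two_cf_den_gt0//.
- by rewrite filter_uniq// iota_uniq.
- move=> n; rewrite mem_filter mem_index_iota ltnS => /andP[/andP[nn' _] nN].
  apply: le_trans (near _ _ nN n'N nn') _.
  rewrite ger0_norm ?subr_ge0 ?xmin// gerBl.
  by case/andP: (fract_part_itv (n'%:R * alpha - gamma)).
- move=> m n; rewrite !mem_filter !mem_index_iota !ltnS.
  by move=> /andP[_ mN] /andP[_ nN]; exact: near.
Qed.

(** Here the threshold itself keeps the points away from 0, so [n'] may lie in the block. *)
Lemma block_sum_le k (r i : nat) : q k = r%:Z ->
  \sum_(i * r <= n < i.+1 * r | (2 * (q k)%:~R)^-1 <= x n) (x n `^ b)^-1 <=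
  (2 * (q k)%:~R) `^ b * series (riemannR b) r.
Proof.
move=> qr; rewrite -big_filter; set s := [seq _ <- _ | _].
have D0 := two_cf_den_gt0 k.
apply: (@le_trans _ _ ((2 * (q k)%:~R) `^ b * series (riemannR b) (size s))).
  apply: sum_inv_powR_spaced_map => //.
  - by rewrite filter_uniq// iota_uniq.
  - by move=> n; rewrite mem_filter => /andP[].
  - move=> m n; rewrite !mem_filter !mem_index_iota !mulSn.
    move=> /andP[_ mi] /andP[_ ni] mn; apply: fract_part_spaced => //.
    by rewrite qr; lia.
rewrite ler_wpM2l ?powR_ge0// series_riemannR_nd//.
apply: leq_trans (size_subseq (filter_subseq _ _)) _.
by rewrite size_iota mulSn addnK.
Qed.

End Orbit.

(** * The bounds for b > 1 and for 0 < b < 1 *)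

Theorem theorem4p1 (R : realType) (N : nat) (alpha gamma : R) (K n' : nat)
    (b : R)
    (hN : (0 < N)%N)
    (halpha : irrational alpha)
    (hK : cf_den alpha K <= N%:Z)
    (hKmax : forall k : nat, cf_den alpha k <= N%:Z -> (k <= K)%N)
    (hn' : (n' <= N)%N)
    (hn'min : forall n : nat, (n <= N)%N ->
       fract_part (n'%:R * alpha - gamma) <= fract_part (n%:R * alpha - gamma))
    (hb : 0 < b) :
  (1 < b ->
     T_sum b N n' alpha gamma <=
       2 `^ (1 + b) * zeta b * N%:R `^ b
       + 2 `^ b * zeta b * (cf_den alpha K.+1)%:~R `^ b) /\
  (b < 1 ->
     T_sum b N n' alpha gamma <=
       2 `^ (1 + b) / (1 - b) * N%:R
       + 2 `^ b / (1 - b) * (cf_den alpha K.+1)%:~R `^ b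
         * (N%:R / (cf_den alpha K)%:~R) `^ (1 - b)).
Proof.
have NQ : N%:Z < cf_den alpha K.+1.
  by rewrite ltNge; apply/negP => /hKmax; rewrite ltnn.
have Q0 : 0 < (cf_den alpha K.+1)%:~R :> R by rewrite ltr0z cf_den_gt0.
have q0 : 0 < (cf_den alpha K)%:~R :> R by rewrite ltr0z cf_den_gt0.
have offmin P :=
  @sum_off_min_le R alpha gamma halpha b hb K.+1 N n' P NQ hn' hn'min.
split=> b1.
  have cz := cvg_series_riemannR b b1.
  have le_zeta n : series (riemannR b) n <= zeta b.
    exact: nondecreasing_cvgn_le (series_riemannR_nd b) cz n.
  have zeta0 : 0 <= zeta b.
    by apply: le_trans (le_zeta 0%N); rewrite /series /= big_geq.
  rewrite -[leLHS]add0r lerD ?mulr_ge0 ?powR_ge0//.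
  rewrite /T_sum; under eq_bigl => n do rewrite -[n != n']andbT.
  apply: le_trans (offmin xpredT) _.
  by rewrite powRM ?(ltW Q0)// mulrAC ler_wpM2r ?ler_wpM2l ?powR_ge0.
have c0 : 0 < 1 - b by lra.
have [r qr] : exists r : nat, cf_den alpha K = r%:Z.
  by exists `|cf_den alpha K|%N; rewrite gez0_abs// ltW// cf_den_gt0.
rewrite qr -pmulrn in q0 *; have r0 : (0 < r)%N by rewrite -(ltr0n R).
have rN : (r <= N)%N by rewrite -lez_nat -qr.
set x := fun n : nat => fract_part (n%:R * alpha - gamma).
pose large n := (2 * r%:R)^-1 <= x n.
rewrite /T_sum (bigID large) /= lerD//.
(* Large points: put [n'] back and extend the range to complete blocks; this only adds nonnegative
   terms. *)
- apply: (@le_trans _ _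
    (\sum_(0 <= n < (N %/ r).+1 * r | large n) (x n `^ b)^-1)).
    rewrite [leRHS](big_cat_nat (n := N.+1))//=; last by rewrite ltn_ceil.
    rewrite -[leLHS]addr0 lerD ?sumr_ge0//; last first.
      by move=> n _; rewrite invr_ge0 powR_ge0.
    rewrite [leRHS](bigID (fun n => n != n')) /=.
    under eq_bigl => n do rewrite andbC.
    by rewrite lerDl sumr_ge0// => n _; rewrite invr_ge0 powR_ge0.
  rewrite big_mkcond big_nat_mul /=.
  under eq_bigr => i _ do rewrite -big_mkcond /=.
  pose B : R := (2 * r%:R) `^ b * (r%:R `^ (1 - b) / (1 - b)).
  apply: (@le_trans _ _ (\sum_(0 <= i < (N %/ r).+1) B)).
    apply: ler_sum => i _.
    have := @block_sum_le R alpha gamma halpha b hb K r i qr.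
    rewrite qr -pmulrn => /le_trans; apply.
    by rewrite ler_wpM2l ?powR_ge0// series_riemannR_le// hb.
  have BE : B = 2 `^ b / (1 - b) * r%:R.
    rewrite /B powRM ?(ltW q0)// powRB ?lt0r_neq0 ?implybT// powRr1 ?(ltW q0)//.
    by field; rewrite !lt0r_neq0// powR_gt0.
  rewrite sumr_const_nat subn0 -[leLHS]mulr_natr BE -mulrA -natrM.
  rewrite powRD ?lt0r_neq0 ?implybT// powRr1// -!mulrA [2 * _]mulrC -!mulrA.
  rewrite !ler_wpM2l ?powR_ge0 ?invr_ge0 ?(ltW c0)//.
  (* (L + 1) r <= N + r <= 2N, the source of the extra factor 2 in 2^(1+b). *)
  by rewrite -natrM ler_nat; have := leq_trunc_div N r; lia.
(* Small points: there are at most L of them, and L <= N/q. *)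
- apply: (@le_trans _ _ ((2 * (cf_den alpha K.+1)%:~R) `^ b *
                         series (riemannR b) (N %/ r)%N)).
    apply: le_trans (offmin _) _; rewrite ler_wpM2l ?powR_ge0//.
    apply: series_riemannR_nd.
    have := @count_small_le R alpha gamma halpha K N r n' qr hn' hn'min.
    by rewrite qr -pmulrn.
  rewrite powRM ?(ltW Q0)// -!mulrA ler_wpM2l ?powR_ge0//.
  rewrite mulrCA ler_wpM2l ?powR_ge0//.
  apply: le_trans (series_riemannR_le b _ _) _; first by rewrite hb.
  rewrite mulrC ler_wpM2l ?invr_ge0 ?(ltW c0)//.
  have dle : (N %/ r)%N%:R <= N%:R / r%:R :> R.
    by rewrite ler_pdivlMr// -natrM ler_nat leq_trunc_div.
  by rewrite ge0_ler_powR ?nnegrE ?divr_ge0 ?ler0n ?(ltW c0).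
Qed.
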